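(* Let $d \geq 2$ and $\varepsilon > 0$. Let $\vartheta_2 = 1/2$ and, for $d \geq 3$, let $\vartheta_d = \frac{2(d+1)}{5d+1}$. Then for all $X \geq 1$, \[ \frac{1}{\# \mathscr{P}_d(X)} \sum_{\psi_{\mathbf{a}} \in \mathscr{P}_d(X)} \# \mathrm{Prep}_{\mathbb{Q}}(\psi_{\mathbf{a}}) \ll \frac{1}{X^{\vartheta_d - \varepsilon}}, \] where the implied constant depends at most on $d$ and $\varepsilon$.
   Context: Let $d \geq 2$. Let $\mathbb{Z}^d_{\mathrm{prim}}$ be the set of $(x_1,\dots,x_d) \in \mathbb{Z}^d$ with $\gcd(x_1,\dots,x_d)=1$. Let $\mathscr{P}_d$ be the set of polynomials $\psi_{\mathbf{a}} \in \mathbb{Q}[z]$ indexed by vectors $\mathbf{a} = (a_d, a_{d-2}, \dots, a_1, a_0) \in \mathbb{Z}^d_{\mathrm{prim}}$ (note there is no index $d-1$) with $a_d \neq 0$ and $a_0 > 0$, where \[ \psi_{\mathbf{a}}(z) = \frac{a_d}{a_0} z^d + \frac{a_{d-2}}{a_0} z^{d-2} + \cdots + \frac{a_1}{a_0} z + 1. \] The height is $\mathscr{H}(\psi_{\mathbf{a}}) = \max\{|a_d|, |a_{d-2}|, \dots, |a_1|, a_0\}$, and $\mathscr{P}_d(X) = \{\psi_{\mathbf{a}} \in \mathscr{P}_d : \mathscr{H}(\psi_{\mathbf{a}}) \leq X\}$. For a map $f : S \to S$, $f^n$ denotes the $n$-th iterate ($f^0$ the identity) and $\mathrm{Prep}_S(f)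 = \{ s \in S : \exists \ell \geq 0, \exists m \geq 1,\ f^{\ell+m}(s) = f^\ell(s)\}$ is the set of preperiodic points. The notation $A \ll B$ means $A = O(B)$. *)

(* Defs.v *)
From HB Require Import structures.
From mathcomp Require Import all_boot all_order all_algebra.
From mathcomp Require Import finmap.
From mathcomp Require Import all_classical all_reals all_analysis.
From mathcomp Require Import zify.

Set Implicit Arguments.
Unset Strict Implicit.
Unset Printing Implicit Defensive.

Import Order.TTheory GRing.Theory Num.Theory.

Local Open Scope classical_set_scope.
Local Open Scope ring_scope.

Definition Prep (S : Type) (f : S -> S) : set S :=
  [set s | exists l m : nat, (1 <= m)%N /\ iter (l + m) f s = iter l f s].

(* For 2 <= d, the vector (a_d, a_(d-2), ..., a_1, a_0), which has no entry of
   index d-1, is the tuple [:: a_0; a_1; ...; a_(d-2); a_d]: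
   a`_k is a_k for k <= d-2, and a`_d.-1 is a_d. *)
Definition primitive (d : nat) (a : d.-tuple int) : Prop :=
  \big[gcdn/0%N]_(x <- a) `|x|%N = 1%N.

Definition admissible (d : nat) (a : d.-tuple int) : Prop :=
  [/\ primitive a, a`_d.-1 != 0 & 0 < a`_0].

Definition psi (d : nat) (a : d.-tuple int) : {poly rat} :=
  ((a`_d.-1)%:~R / (a`_0)%:~R) *: 'X^d
  + \sum_(1 <= k < d.-1) ((a`_k)%:~R / (a`_0)%:~R) *: 'X^k + 1.

Definition height (d : nat) (a : d.-tuple int) : nat :=
  \max_(x <- a) `|x|%N.

(* The height of a polynomial is read off its index vector, which is unique
   by [psi_inj]. *)
Definition polys (R : realType) (d : nat) (X : R) : set {poly rat} :=
  [set psi a | a in [set a : d.-tuple int |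
                      admissible a /\ (height a)%:R <= X]].

Definition theta (R : realType) (d : nat) : R :=
  if d == 2%N then 1 / 2 else (2 * (d%:R + 1)) / (5 * d%:R + 1).

Lemma coef_psi (d : nat) (a : d.-tuple int) (k : nat) :
  (2 <= d)%N -> a`_0 != 0 -> (k < d)%N ->
  (psi a)`_(bump d.-1 k) = (a`_k)%:~R / (a`_0)%:~R.
Proof.
move=> d2 a0 kd; rewrite /psi !coefD coefZ coefXn coef1 coef_sum.
under eq_bigr do rewrite coefZ coefXn.
have [kd1|kd1] := ltnP k d.-1.
  rewrite /bump leqNgt kd1 add0n (ltn_eqF kd) mulr0 add0r /=.
  case: k kd kd1 => [|k] kd kd1.
    rewrite big_nat big1 ?add0r ?divff ?intr_eq0// => i /andP[i0 _].
    by rewrite (ltn_eqF i0) mulr0.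
  rewrite addr0 (bigD1_seq k.+1) ?mem_index_iota ?iota_uniq//=.
  rewrite eqxx mulr1 big1 ?addr0// => i ik.
  by rewrite eq_sym (negPf ik) mulr0.
have -> : k = d.-1 by apply/eqP; rewrite eqn_leq kd1 -ltnS prednK ?kd ?(ltnW d2).
rewrite /bump leqnn add1n prednK ?(ltnW d2)// eqxx mulr1.
rewrite big_nat big1 => [|i /andP[_ id]].
  by rewrite addr0 (gtn_eqF (ltnW d2)) addr0.
by rewrite gtn_eqF ?mulr0// (leq_trans id)// leq_pred.
Qed.

Lemma dvdn_mul_primitive (s : seq int) (m n : nat) :
  (forall k, (m %| n * `|(s`_k)%R|)%N) ->
  (m %| n * \big[gcdn/0%N]_(x <- s) `|x|%N)%N.
Proof.
elim: s => [|x s IH] H; first by rewrite big_nil muln0.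
rewrite big_cons muln_gcdr dvdn_gcd (H 0%N) /=.
by apply: IH => k; apply: (H k.+1).
Qed.

Lemma psi_inj (d : nat) (a b : d.-tuple int) : (2 <= d)%N ->
  admissible a -> admissible b -> psi a = psi b -> a = b.
Proof.
move=> d2 [pa _ a0] [pb _ b0] ab.
have a0n : a`_0 != 0 by rewrite gt_eqF.
have b0n : b`_0 != 0 by rewrite gt_eqF.
have cross k : b`_0 * a`_k = a`_0 * b`_k.
  have [kd|dk] := ltnP k d; last first.
    by rewrite !(@nth_default _ _ _ k) ?size_tuple// !mulr0.
  have := coef_psi d2 a0n kd; rewrite ab coef_psi// => /eqP.
  rewrite eqr_div ?intr_eq0// -!intrM eqr_int => /eqP akb.
  by rewrite mulrC -akb mulrC.
have absE k : (`|(b`_0)%R| * `|(a`_k)%R| = `|(a`_0)%R| * `|(b`_k)%R|)%N.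
  by rewrite -!abszM cross.
have ab0 : a`_0 = b`_0.
  suff : `|(a`_0)%R|%N = `|(b`_0)%R|%N.
    by move=> /(congr1 Posz); rewrite !gez0_abs ?ltW.
  apply/eqP; rewrite eqn_dvd; apply/andP; split.
    rewrite -[X in (_ %| X)%N]muln1 -pa dvdn_mul_primitive// => k.
    by rewrite absE dvdn_mulr.
  rewrite -[X in (_ %| X)%N]muln1 -pb dvdn_mul_primitive// => k.
  by rewrite -absE dvdn_mulr.
apply: val_inj; apply: (@eq_from_nth _ 0); rewrite ?size_tuple// => k _.
by have := cross k; rewrite ab0 => /(mulfI b0n).
Qed.

Lemma finite_polys (R : realType) (d : nat) (X : R) : finite_set (polys d X).
Proof.
apply: finite_image.
pose N := Num.truncn X.
pose dec (t : d.-tuple 'I_(N + N).+1) : d.-tuple int :=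
  map_tuple (fun i : 'I_(N + N).+1 => i%:Z - N%:Z) t.
apply: (@sub_finite_set _ _ (range dec)); last exact: finite_image.
move=> a [_ hX].
have hN x : x \in a -> (`|x| <= N)%N.
  move=> xa; apply: (@leq_trans (height a)).
    by rewrite /height (big_rem x)//= leq_maxl.
  have X0 : 0 <= X by apply: le_trans hX.
  by rewrite /N truncn_ge_nat.
exists (map_tuple (fun x : int => inord (absz (x + N%:Z))) a) => //.
apply: val_inj => /=; rewrite -map_comp; apply: map_id_in => x xa /=.
have xN := hN _ xa.
by rewrite inordK; lia.
Qed.

(* Main.v *)
(* Let N be the integer part of X and let z be preperiodic under psi_a. Its orbit
   s is finite; write its elements as u/L with L the least common denominator. The
   orbit relation from u/L to u'/L reads
     F(u, L) = a_0 L^(d-1) (u' - L),  F(u, L) = a_d u^d + sum_k a_k u^k L^(d-k).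
   For d >= 3 it forces L^2 | a_d, because the numerators of s have no common factor
   with L, and then, at the point of s of largest absolute value, u^2 <= d N. So
   (a_1, ..., a_d), L and u take O(N^(d-1/2+eps)) values, and a_0 is a divisor of
   F(u, L), which leaves O(N^eps) choices unless F(u, L) = 0. In that case
   psi_a(z) = 1 and the orbit relation at 1 shows that a_0 divides
   a_d (a_1 + ... + a_d); if this sum vanishes too, a_d is determined by the other
   coefficients and a_0 may be arbitrary.
   For d = 2 the conjugate orbit of Z = (a_2/a_0) z under Z^2 + a_2/a_0, with least
   common denominator M, satisfies a_0 = M^2 and a_2 = U' M - U^2 with
   M, U, U' = O(N^(1/2)), hence O(N^(3/2)) pairs.
   Either way there are O(N^(d-1/2+eps)) pairs (a, z), and the coprimality of a_0
   and a_d alone shows that there are at least N^d/4 polynomials. The saving 1/2 is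
   at least theta_d. *)
Require Import Defs.
From HB Require Import structures.
From mathcomp Require Import all_boot all_order all_algebra.
From mathcomp Require Import finmap.
From mathcomp Require Import all_classical all_reals all_analysis.
From mathcomp Require Import zify ring lra.

Set Implicit Arguments.
Unset Strict Implicit.
Unset Printing Implicit Defensive.

Import Order.TTheory GRing.Theory Num.Theory.

Local Open Scope classical_set_scope.
Local Open Scope ring_scope.

(** * Growth of the number of divisors *)

Lemma size_divisors (n : nat) :
  size (divisors n) = (\prod_(f <- prime_decomp n) f.2.+1)%N.
Proof.
rewrite /divisors unlock /=; elim: (prime_decomp n) => [//|[p e] s IH] /=.
rewrite -IH; move: (foldr _ _ _) => l; elim: e => [|e IHe] /=.
  by rewrite mul1n.
by rewrite size_merge size_cat size_map IHe [RHS]mulSn addnC.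
Qed.

(** With q the quotient of e by k+1, e + 1 <= (k+1)(q+1) <= (k+1) 2^q; raise this to the power
    k+1. *)
Lemma expS_le_exp2 (k e : nat) : (e.+1 ^ k.+1 <= k.+1 ^ k.+1 * 2 ^ e)%N.
Proof.
pose q := (e %/ k.+1)%N.
have qe : (q * k.+1 <= e)%N by rewrite leq_divM.
have : (e.+1 <= k.+1 * 2 ^ q)%N.
  apply: (@leq_trans (k.+1 * q.+1)%N); first by rewrite mulnC ltn_ceil.
  by rewrite leq_pmul2l// ltn_expl.
move=> h; apply: (@leq_trans ((k.+1 * 2 ^ q) ^ k.+1)%N); first by rewrite leq_exp2r.
by rewrite expnMn -expnM leq_pmul2l ?expn_gt0// leq_exp2l.
Qed.

(** Compare (e+1)^(k+1) with p^e, one prime power at a time. If p >= 2^(k+1), then (e+1)^(k+1) <=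
    2^(e(k+1)) <= p^e. A smaller p costs a factor (k+1)^(k+1), and there are at most 2^(k+1) such
    primes. *)
Lemma divisors_bound (k : nat) : exists C : nat, forall n : nat, (0 < n)%N ->
  (size (divisors n) ^ k.+1 <= C * n)%N.
Proof.
pose A := (k.+1 ^ k.+1)%N; pose P := (2 ^ k.+1)%N.
have A0 : (0 < A)%N by rewrite expn_gt0.
exists (A ^ P)%N => n n0; rewrite size_divisors.
rewrite [X in (_ <= _ * X)%N](prod_prime_decomp n0).
have : all (fun f => (1 < f.1)%N) (prime_decomp n).
  by apply/allP => -[p e] /mem_prime_decomp[pp _ _]; exact: prime_gt1.
have : (count (fun f => (f.1 < P)%N) (prime_decomp n) <= P)%N.
  have -> : count (fun f => (f.1 < P)%N) (prime_decomp n) =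
            size [seq p <- primes n | (p < P)%N].
    by rewrite size_filter /primes /unzip1 count_map.
  rewrite -[leqRHS](size_iota 0); apply: uniq_leq_size.
    by rewrite filter_uniq// primes_uniq.
  by move=> p; rewrite mem_filter mem_iota add0n => /andP[->].
set c := count _ _ => cP s1.
apply: (@leq_trans (A ^ c * \prod_(f <- prime_decomp n) f.1 ^ f.2)%N); last first.
  by rewrite leq_mul2r leq_pexp2l// orbT.
rewrite {cP}/c; elim: (prime_decomp n) s1 => [|[p e] s IH] /=; first by rewrite !big_nil exp1n.
move=> /andP[p1 /IH{}IH]; rewrite !big_cons /= expnMn expnD mulnACA leq_mul//.
have [pP|Pp] := ltnP p P; rewrite /= ?expn1 ?expn0.
  rewrite (leq_trans (expS_le_exp2 _ _))// leq_mul2l orbC.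
  by case: e => [|e]; rewrite ?expn0 ?leq_exp2r ?p1.
rewrite mul1n; apply: (@leq_trans ((2 ^ e) ^ k.+1)%N); first by rewrite leq_exp2r// ltn_expl.
by rewrite -expnM mulnC expnM; case: e => [|e]; rewrite ?expn0 ?leq_exp2r.
Qed.

(** * Finite orbits and common denominators *)

Lemma prep_orbit (T : eqType) (f : T -> T) (z : T) : Prep f z ->
  exists s : seq T, z \in s /\ {in s, forall w, f w \in s}.
Proof.
move=> [l [m [m0 lm]]]; exists (traject f z (l + m)).
have lm0 : (0 < l + m)%N by rewrite addn_gt0 m0 orbT.
have inO i : (i < l + m)%N -> iter i f z \in traject f z (l + m).
  by move=> ilm; apply/trajectP; exists i.
split; first exact: (inO 0%N).
move=> _ /trajectP[i ilm ->]; rewrite -iterS.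
move: ilm; rewrite leq_eqVlt => /predU1P[->|/inO//].
by rewrite lm inO// -[ltnLHS]addn0 ltn_add2l.
Qed.

(* The last clause says that the numerators u w have no common factor with L, in a
   form that applies to powers. *)
Lemma common_den (s : seq rat) : exists (L : nat) (u : rat -> int),
  [/\ (0 < L)%N, {in s, forall w, w = (u w)%:~R / L%:R} &
    forall Q n e e' : nat, (Q %| L ^ e')%N ->
      {in s, forall w, (Q %| n * `|u w| ^ e)%N} -> (Q %| n)%N].
Proof.
pose L := \big[lcmn/1%N]_(w <- s) `|denq w|%N.
have denL w : w \in s -> (`|denq w| %| L)%N.
  by move=> ws; rewrite /L (big_rem w)//= dvdn_lcml.
have Lmin m : {in s, forall w, (`|denq w| %| m)%N} -> (L %| m)%N.
  rewrite /L => H; rewrite big_seq; elim/big_ind: _ => //.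
  by move=> x y xm ym; rewrite dvdn_lcm xm.
have L0 : (0 < L)%N.
  rewrite /L; elim/big_ind: _ => //; first by move=> x y; rewrite lcmn_gt0 => ->.
  by move=> w _; rewrite absz_gt0 denq_neq0.
pose u w := numq w * (L %/ `|denq w|)%N%:Z.
exists L, u; split=> //.
  move=> w ws; rewrite /u -[LHS]divq_num_den intrM.
  have -> : L%:R = (L %/ `|denq w|)%N%:R * (denq w)%:~R :> rat.
    rewrite -[in LHS](divnK (denL _ ws)) natrM; congr (_ * _).
    by rewrite -[LHS]/((`|denq w|%N%:Z)%:~R) absz_denq.
  have : (L %/ `|denq w|)%N%:R != 0 :> rat.
    by rewrite pnatr_eq0 -lt0n divn_gt0 ?absz_gt0 ?denq_neq0// dvdn_leq// denL.
  have : (denq w)%:~R != 0 :> rat by rewrite intr_eq0 denq_neq0.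
  rewrite -[(L %/ _)%N%:Z%:~R]/((L %/ `|denq w|)%N%:R : rat).
  by move=> h1 h2; field; apply/andP.
move=> Q n e e' QL QU.
pose G := \big[gcdn/0%N]_(x <- [seq u w ^+ e | w <- s]) `|x|%N.
have : (Q %| n * G)%N.
  apply: dvdn_mul_primitive => k.
  have [ks|sk] := ltnP k (size s); last by rewrite nth_default ?size_map// absz0 muln0.
  by rewrite (nth_map 0)// abszX QU// mem_nth.
rewrite Gauss_dvdl//; apply: coprime_dvdl QL _; rewrite coprimeXl//.
(* A prime p dividing L and every [u w] would make every denominator divide L/p, against the
   minimality of L. *)
rewrite /coprime; apply/negPn/negP => g1.
have gL : (gcdn L G %| L)%N by rewrite dvdn_gcdl.
have g0 : (0 < gcdn L G)%N by rewrite gcdn_gt0 L0.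
have pp : prime (pdiv (gcdn L G)) by rewrite pdiv_prime// ltn_neqAle eq_sym g1.
set p := pdiv _ in pp.
have pL : (p %| L)%N by rewrite (dvdn_trans (pdiv_dvd _)).
have pu w : w \in s -> (p %| `|u w|)%N.
  move=> ws; have : (p %| `|u w ^+ e|)%N.
    rewrite (dvdn_trans (pdiv_dvd _))// (dvdn_trans (dvdn_gcdr _ _))//.
    by rewrite /G big_map (big_rem w)//= dvdn_gcdl.
  by rewrite abszX Euclid_dvdX// => /andP[].
have : (L %| L %/ p)%N.
  apply: Lmin => w ws; rewrite -(dvdn_pmul2l (prime_gt0 pp)) [(p * (_ %/ _))%N]mulnC divnK//.
  have := pu w ws; rewrite /u abszM absz_nat Euclid_dvdM// => /orP[pn|].
    rewrite Gauss_dvd ?pL ?denL//.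
    by rewrite (coprime_dvdl pn)// coprime_num_den.
  by move=> pd; rewrite -[X in (_ %| X)%N](divnK (denL w ws)) dvdn_mul.
move/dvdn_leq; rewrite divn_gt0 ?prime_gt0// dvdn_leq// => /(_ isT).
by rewrite leqNgt ltn_Pdiv// prime_gt1.
Qed.

(** * Density of coprime pairs *)

Lemma sum_dvd (g n : nat) : (0 < g)%N ->
  (\sum_(i < n) (g %| i.+1) = n %/ g)%N.
Proof.
move=> g0; elim: n => [|n IH]; first by rewrite big_ord0 div0n.
by rewrite big_ord_recr /= IH divnS// addnC.
Qed.

(** Telescoping of 1/g^2 <= 1/(g-1) - 1/g. Starting at 3 leaves the term 1/4 of g = 2 exact, so the
    sum from 2 on stays below 3/4; telescoping from 2 would only give 1. *)
Lemma sum_inv_sq (F : realFieldType) (m : nat) :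
  \sum_(3 <= g < m.+3) 1 / (g%:R ^+ 2) <= 1 / 2 - 1 / m.+2%:R :> F.
Proof.
elim: m => [|m IH]; first by rewrite big_geq// subrr.
rewrite big_nat_recr//=; move: IH; rewrite -[m.+3%:R]natr1.
have : 0 < m.+2%:R :> F by rewrite ltr0n.
move: (m.+2%:R) (\sum_(_ <= _ < _) _) => x y x0.
have : 1 / (x + 1) ^+ 2 <= 1 / x - 1 / (x + 1).
  have x1 : 0 < x + 1 by rewrite ltr_wpDr.
  have -> : 1 / x - 1 / (x + 1) = 1 / (x * (x + 1)).
    by field; rewrite !gt_eqF.
  rewrite !div1r lef_pV2 ?posrE ?exprn_gt0 ?mulr_gt0//.
  by rewrite expr2 ler_pM2r// ler_wpDr.
move: (1 / x) (1 / (x + 1)) (1 / (x + 1) ^+ 2) => p q r; lra.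
Qed.

Lemma sum_divn_sq (F : realFieldType) (n : nat) :
  4 * \sum_(2 <= g < n.+1) ((n %/ g) ^ 2)%:R <= 3 * n%:R ^+ 2 :> F.
Proof.
case: n => [|[|n]]; only 1,2: by rewrite big_geq// mulr0 mulr_ge0 ?sqr_ge0.
have n0 : 0 < n.+2%:R :> F by rewrite ltr0n.
have sq g : (0 < g)%N -> ((n.+2 %/ g) ^ 2)%:R <= n.+2%:R ^+ 2 * (1 / g%:R ^+ 2) :> F.
  move=> g0; rewrite natrX mul1r -expr_div_n lerXn2r ?nnegrE ?divr_ge0//.
  by rewrite ler_pdivlMr ?ltr0n// -natrM ler_nat leq_divM.
apply: (@le_trans _ _ (4 * (n.+2%:R ^+ 2 *
    (1 / 4 + \sum_(3 <= g < n.+3) 1 / (g%:R ^+ 2))))).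
  rewrite ler_pM2l ?ltr0n// mulrDr mulr_sumr big_ltn//; apply: lerD.
    by rewrite (le_trans (sq _ _))// ; lra.
  rewrite big_nat [leRHS]big_nat; apply: ler_sum => g /andP[g2 _].
  by apply: sq; apply: leq_trans g2.
have := sum_inv_sq F n.
have : 0 < 1 / n.+2%:R :> F by rewrite divr_gt0.
have : 0 <= n.+2%:R ^+ 2 :> F by rewrite sqr_ge0.
move: (1 / n.+2%:R) (n.+2%:R ^+ 2) (\sum_(_ <= _ < _) _) => x y w; nra.
Qed.

(** A pair that is not coprime is counted at g = gcd >= 2 among the (n/g)^2 pairs of multiples of g.
    By [sum_divn_sq] these are at most 3/4 of all pairs. *)
Lemma card_coprime_pairs (n : nat) :
  (n ^ 2 <= 4 * #|[set p : 'I_n * 'I_n | coprime p.1.+1 p.2.+1]%SET|)%N.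
Proof.
set E := [set _ | _]%SET.
have : (#|~: E| <= \sum_(2 <= g < n.+1) (n %/ g) ^ 2)%N.
  have -> : #|~: E| = (\sum_(i < n) \sum_(j < n) ((i, j) \notin E))%N.
    rewrite -sum1_card big_mkcond pair_bigA /=; apply: eq_bigr => -[i j] _.
    by rewrite inE; case: ifP.
  apply: (@leq_trans (\sum_(i < n) \sum_(j < n)
      \sum_(2 <= g < n.+1) (g %| i.+1) * (g %| j.+1))%N).
    apply: leq_sum => i _; apply: leq_sum => j _.
    rewrite !inE /=; case: (boolP (coprime _ _)) => // cij.
    have g0 : (0 < gcdn i.+1 j.+1)%N by rewrite gcdn_gt0.
    rewrite (bigD1_seq (gcdn i.+1 j.+1)) ?iota_uniq//=.
      by rewrite dvdn_gcdl dvdn_gcdr.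
    rewrite mem_index_iota ltnS (leq_trans (dvdn_leq _ (dvdn_gcdl _ _)))// andbT.
    by rewrite ltn_neqAle eq_sym g0 andbT; exact: cij.
  rewrite (eq_bigr (fun i : 'I_n => \sum_(2 <= g < n.+1)
      \sum_(j < n) (g %| i.+1) * (g %| j.+1))%N); last first.
    by move=> i _; rewrite exchange_big.
  rewrite exchange_big /= big_nat [leqRHS]big_nat; apply: leq_sum => g /andP[g2 _].
  by rewrite -big_distrlr /= sum_dvd ?(ltnW g2)// mulnn.
have := sum_divn_sq rat n; rewrite -natr_sum -natrX -!natrM ler_nat.
have := cardsC E.
rewrite card_prod card_ord; set S := (\sum_(_ <= _ < _) _)%N; lia.
Qed.

(** * Counting by lists of pairs, and a lower bound for the number of polynomials *)

(** The fibre of W over f contains [P f], which is therefore finite, so [counting] does not take the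
    value +oo; distinct f use disjoint parts of W. *)
Lemma sum_counting_le (R : realType) (I J : choiceType) (A : set I)
    (P : I -> set J) (W : seq (I * J)) : finite_set A ->
  (forall f z, A f -> P f z -> (f, z) \in W) ->
  (\sum_(f \in A) @counting _ R (P f) <= (size W)%:R%:E)%E.
Proof.
move=> finA PW.
pose Wf f := [seq p.2 | p <- W & p.1 == f].
have PWf f : A f -> P f `<=` [set` Wf f].
  move=> Af z /(PW _ _ Af) fzW /=; apply/mapP; exists (f, z) => //.
  by rewrite mem_filter eqxx.
rewrite fsbig_finite//=.
apply: (@le_trans _ _ (\sum_(f <- fset_set A) (count (fun p => p.1 == f) W)%:R%:E)%E).
  rewrite big_seq [leRHS]big_seq; apply: lee_sum => f.
  rewrite in_fset_set// inE => Af.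
  have fin : finite_set (P f) := sub_finite_set (PWf f Af) (finite_seq _).
  rewrite /counting asboolT// lee_fin ler_nat.
  rewrite -size_filter -(size_map (fun p => p.2)).
  apply: uniq_leq_size; first exact: fset_uniq.
  by move=> z; rewrite in_fset_set// inE => /(PWf _ Af).
rewrite sumEFin lee_fin -natr_sum ler_nat.
have := fset_uniq (fset_set A); elim: W {PW Wf PWf} => [|p W IH] us.
  by rewrite big1.
rewrite /= big_split /= -[leqRHS]add1n leq_add//; last exact: IH.
have [pA|pA] := boolP (p.1 \in fset_set A).
  rewrite (bigD1_seq p.1)//= eqxx big1// => i ip.
  by rewrite eq_sym (negPf ip).
rewrite big_seq big1// => i iA; apply/eqP; rewrite eqb0; apply: contra pA => /eqP->.
exact: iA.
Qed.

Definition mkvec (n : nat) (a0 : int) (t : n.-tuple int) (ad : int) :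
  n.+2.-tuple int := [tuple of a0 :: rcons t ad].

Lemma mkvec_last (n : nat) (a0 : int) (t : n.-tuple int) (ad : int) :
  (mkvec a0 t ad)`_n.+1 = ad.
Proof. by rewrite /= nth_rcons size_tuple ltnn eqxx. Qed.

Lemma mkvecE (n : nat) (a : n.+2.-tuple int) :
  exists t : n.-tuple int, a = mkvec a`_0 t a`_n.+1.
Proof.
case/tupleP: a => a0 b; exists [tuple b`_k | k < n].
apply: val_inj => /=; congr cons.
apply: (@eq_from_nth _ 0).
  by rewrite size_rcons size_map size_enum_ord size_tuple.
move=> k; rewrite size_tuple ltnS nth_rcons size_map size_enum_ord => kn.
case: ltnP => [lkn|nk].
  by rewrite (nth_map (Ordinal lkn)) ?size_enum_ord// nth_enum_ord.
have -> : k = n by lia.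
by rewrite eqxx.
Qed.

Lemma height_le (d : nat) (a : d.-tuple int) (N : nat) :
  (height a <= N)%N = all (fun x : int => (`|x| <= N)%N) a.
Proof.
rewrite /height; elim: (tval a) => [|x s IH]; first by rewrite big_nil.
by rewrite big_cons geq_max IH.
Qed.

(** Take a_0 and a_d coprime in [1, N], which already makes the vector primitive, and the n middle
    entries freely in [0, N-1]; [psi_inj] keeps the polynomials distinct. *)
Lemma card_polys (R : realType) (n : nat) (X : R) : 1 <= X ->
  (Num.truncn X ^ n.+2 <= 4 * #|` fset_set (polys n.+2 X)|%fset)%N.
Proof.
move=> X1; set N := Num.truncn X.
pose E := [set p : 'I_N * 'I_N | coprime p.1.+1 p.2.+1]%SET.
pose g (x : ('I_N * 'I_N) * n.-tuple 'I_N) : n.+2.-tuple int :=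
  mkvec x.1.1.+1%:Z (map_tuple (fun i : 'I_N => i%:Z) x.2) x.1.2.+1%:Z.
pose D := finset.setX E [set: n.-tuple 'I_N]%SET.
have admg x : x \in D -> admissible (g x).
  rewrite !inE andbT => co; split=> //; last by rewrite /g mkvec_last.
  have gdvd y : y \in (g x : seq int) ->
      (\big[gcdn/0%N]_(x <- g x) `|x|%N %| `|y|)%N.
    by move=> yg; rewrite (big_rem y)//= dvdn_gcdl.
  apply/eqP; rewrite -dvdn1 -(eqP co) dvdn_gcd.
  by rewrite (gdvd x.1.1.+1%:Z) ?(gdvd x.1.2.+1%:Z)// !inE ?eqxx// mem_rcons inE eqxx ?orbT.
have heightg x : (height (g x) <= N)%N.
  rewrite height_le /= ltn_ord all_rcons ltn_ord/= all_map.
  by apply/allP => i _ /=; exact: ltnW.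
have ginj : injective g.
  move=> [[i j] t] [[i' j'] t'] /(congr1 val) /= [ii'] /rcons_inj[tt' jj'].
  congr ((_, _), _); apply: val_inj => //=; move: tt'.
  by apply: inj_map => x y []/val_inj.
have : (#|D| <= #|` fset_set (polys n.+2 X)|%fset)%N.
  rewrite cardE -(size_map (fun x => psi (g x))); apply: uniq_leq_size.
    rewrite map_inj_in_uniq ?enum_uniq// => x y.
    rewrite !mem_enum => /admg xD /admg yD /(psi_inj (isT : (2 <= n.+2)%N) xD yD).
    exact: ginj.
  move=> _ /mapP[x + ->]; rewrite mem_enum => /admg xD.
  rewrite in_fset_set; last exact: finite_polys.
  rewrite inE; exists (g x) => //; split=> //.
  by rewrite -truncn_ge_nat ?(le_trans ler01).
rewrite cardsX cardsT card_tuple card_ord.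
have := card_coprime_pairs N; rewrite -/E => cE cD.
rewrite -addn2 expnD mulnC (leq_trans (leq_mul cE (leqnn _)))//.
by rewrite addn2 -mulnA leq_mul2l.
Qed.

(** * Arithmetic of preperiodic points in degree at least 3 *)

(* F(u, v): the homogenization of a_0 (psi_a - 1). *)
Definition hform (n : nat) (t : n.-tuple int) (ad u v : int) : int :=
  ad * u ^+ n.+2 + \sum_(k < n) t`_k * u ^+ k.+1 * v ^+ (n.+1 - k).

Lemma psi_eval (n : nat) (t : n.-tuple int) (a0 ad u v u' : int) :
    a0 != 0 -> v != 0 ->
  (psi (mkvec a0 t ad)).[u%:~R / v%:~R] = u'%:~R / v%:~R ->
  hform t ad u v = a0 * v ^+ n.+1 * (u' - v).
Proof.
move=> a00 v0; rewrite /psi !hornerD hornerZ hornerXn hornerC mkvec_last.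
rewrite horner_sum big_add1 /= big_mkord => h.
apply/eqP; rewrite -(eqr_int rat); apply/eqP.
have {}a00 : a0%:~R != 0 :> rat by rewrite intr_eq0.
have {}v0 : v%:~R != 0 :> rat by rewrite intr_eq0.
have -> : (a0 * v ^+ n.+1 * (u' - v))%:~R =
    a0%:~R * v%:~R ^+ n.+2 * (u'%:~R / v%:~R - 1) :> rat.
  by rewrite !(rmorphM, rmorphB, rmorphXn)/= [_ ^+ n.+2]exprSr; move: (_ ^+ n.+1) => y; field.
rewrite -h addrK mulrDr mulr_sumr /hform rmorphD /= rmorph_sum /=; congr (_ + _).
  by rewrite rmorphM rmorphXn expr_div_n /=; field; rewrite a00 expf_neq0.
apply: eq_bigr => k _; rewrite hornerZ hornerXn nth_rcons size_tuple ltn_ord.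
rewrite !(rmorphM, rmorphXn)/= expr_div_n.
have -> : v%:~R ^+ n.+2 = v%:~R ^+ (n.+1 - k) * v%:~R ^+ k.+1 :> rat.
  by rewrite -exprD addnS subnK// ltnW// ltnS ltnW.
by field; rewrite a00 expf_neq0.
Qed.

Lemma seq_max (T : eqType) (f : T -> nat) (s : seq T) (z : T) : z \in s ->
  exists2 w, w \in s & {in s, forall x, (f x <= f w)%N}.
Proof.
elim: s z => [//|x s IH] z _; case: s IH => [|y s] IH.
  by exists x; rewrite ?mem_head// => w; rewrite inE => /eqP->.
have [w ws wmax] := IH y (mem_head _ _).
have [xw|wx] := leqP (f x) (f w).
  by exists w; [rewrite inE ws orbT|move=> v; rewrite inE => /predU1P[->//|/wmax]].
exists x; first by rewrite mem_head.
move=> v; rewrite inE => /predU1P[->//|/wmax vw].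
exact: leq_trans vw (ltnW wx).
Qed.

Lemma hform_scale (n : nat) (t : n.-tuple int) (ad v : int) :
  hform t ad v v = v ^+ n.+2 * hform t ad 1 1.
Proof.
rewrite /hform mulrDr mulr_sumr expr1n mulr1 mulrC; congr (_ + _).
apply: eq_bigr => k _; rewrite !expr1n !mulr1 -mulrA -exprD mulrC.
by rewrite addSn subnKC// ltnW// ltnS ltnW.
Qed.

(** The orbit relation is used along the whole orbit: divisibility by L^2 needs all numerators, the
    size bound the largest one, and the last clause the point 1. *)
Lemma preperiodic_constraints (n N : nat) (t : n.-tuple int) (a0 ad : int) (z : rat) :
    (0 < n)%N -> ad != 0 -> 0 < a0 -> `|a0| <= N%:Z -> `|ad| <= N%:Z ->
    (forall k : 'I_n, `|t`_k| <= N%:Z) ->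
    Prep (fun z : rat => (psi (mkvec a0 t ad)).[z]) z ->
  exists (L : nat) (u : int),
    [/\ z = u%:~R / L%:R, (L ^ 2 %| `|ad|)%N, (`|u| ^ 2 <= n.+2 * N)%N,
        (`|a0| %| `|hform t ad u L|)%N &
        hform t ad u L = 0 -> (`|a0| %| `|(ad * hform t ad 1 1)%R|)%N].
Proof.
move=> n0 ad0 a00 a0N adN tN /prep_orbit[s [zs cl]].
have [L [u [L0 uE Lmin]]] := common_den s.
pose f w := (psi (mkvec a0 t ad)).[w]; have {}cl : {in s, forall w, f w \in s} by [].
have uEf w : w \in s -> f w = (u (f w))%:~R / L%:R by move=> ws; apply: uE; apply: cl.
have lL : 0 < L%:Z by [].
have Lr : L%:R != 0 :> rat by rewrite pnatr_eq0 -lt0n.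
have eqn w : w \in s -> hform t ad (u w) L = a0 * L%:Z ^+ n.+1 * (u (f w) - L%:Z).
  move=> ws; apply: psi_eval; rewrite ?gt_eqF//.
  by rewrite -(uE _ ws) -uEf.
(* As n > 0, every term of the relation except a_d u^(n+2) carries at least L^2. Hence L^2 divides
   a_d u^(n+2) at each point, and the last clause of [common_den] removes the power of u. *)
have L2 : (L ^ 2 %| `|ad|)%N.
  apply: (Lmin _ _ n.+2 2 (dvdnn _)) => w ws.
  have : (L%:Z ^+ 2 %| ad * u w ^+ n.+2)%Z.
    rewrite -[X in (_ %| X)%Z](addrK (\sum_(k < n) t`_k * u w ^+ k.+1 * L%:Z ^+ (n.+1 - k))).
    rewrite -/(hform t ad (u w) L) eqn//; apply: rpredB.
      by rewrite dvdz_mulr// dvdz_mull// dvdz_exp2l.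
    apply: rpred_sum => k _; rewrite dvdz_mull// dvdz_exp2l//.
    by have := ltn_ord k; lia.
  by rewrite dvdzE abszX abszM abszX.
have ladL : L%:Z ^+ 2 <= `|ad|.
  by have := dvdn_leq _ L2; rewrite absz_gt0 => /(_ ad0); lia.
exists L, (u z); split=> //; first exact: uE.
- have [w ws wmax] := seq_max (fun w => `|u w|%N) zs.
  apply: (@leq_trans (`|u w| ^ 2)%N); first by rewrite leq_exp2r// wmax.
  suff : `|u w| ^+ 2 <= (n.+2 * N)%N%:Z by lia.
  set U : int := `|u w|.
  (* If U <= L, then U^2 <= L^2 <= |a_d| <= N at once. *)
  have [UL|LU] := leP U L%:Z.
    have : U ^+ 2 <= L%:Z ^+ 2 by rewrite lerXn2r ?nnegrE.
    by nia.
  have U0 : 0 < U by lia.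
  have key (i j : nat) : (i + j)%N = n.+2 -> (1 < j)%N ->
      U ^+ i * L%:Z ^+ j <= U ^+ n * L%:Z ^+ 2.
    move=> ij j1; have -> : n = (i + (j - 2))%N by lia.
    rewrite -[in leLHS](subnK j1) !exprD mulrA ler_pM2r ?exprn_gt0//.
    by rewrite ler_pM2l ?exprn_gt0// lerXn2r ?nnegrE ?ltW.
  (* By [key], each monomial with at least two factors L is at most U^n L^2. The sum gives n of
     them; a_0 L^(n+1) (u' - L) gives 2 more, since |u'| <= U by maximality. Cancelling U^n and then
     L^2 <= |a_d| leaves U^2 <= (n+2) N. *)
  have : `|ad| * U ^+ n.+2 <= (n.+2 * N)%N%:Z * (U ^+ n * L%:Z ^+ 2).
    have -> : `|ad| * U ^+ n.+2 = `|ad * u w ^+ n.+2| by rewrite normrM normrX.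
    rewrite -[X in `|X|](addrK (\sum_(k < n) t`_k * u w ^+ k.+1 * L%:Z ^+ (n.+1 - k))).
    rewrite -/(hform t ad (u w) L) eqn// (le_trans (ler_normB _ _))//.
    have -> : (n.+2 * N)%N%:Z * (U ^+ n * L%:Z ^+ 2) =
        N%:Z * (U ^+ n * L%:Z ^+ 2) * 2 + \sum_(k < n) N%:Z * (U ^+ n * L%:Z ^+ 2).
      by rewrite sumr_const card_ord -mulr_natr natz; lia.
    apply: lerD.
      have -> : `|a0 * L%:Z ^+ n.+1 * (u (f w) - L%:Z)| =
          `|a0| * (L%:Z ^+ n.+1 * `|u (f w) - L%:Z|).
        by rewrite normrM normrM (ger0_norm (exprn_ge0 _ (ltW lL))) mulrA.
      rewrite -[leRHS]mulrA; apply: ler_pM; rewrite ?mulr_ge0 ?exprn_ge0//.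
      have : `|u (f w) - L%:Z| <= U + L%:Z.
        by have := wmax _ (cl _ ws); rewrite /U; lia.
      move=> /(ler_wpM2l (exprn_ge0 n.+1 (ltW lL)))/le_trans; apply.
      have := @key 1%N n.+1 erefl n0; have := @key 0%N n.+2 erefl isT.
      rewrite expr0 expr1 mul1r [_ ^+ n.+2]exprSr.
      by nia.
    apply: (le_trans (ler_norm_sum _ _ _)); apply: ler_sum => k _.
    rewrite normrM normrM !normrX (ger0_norm (ltW lL)) -mulrA.
    apply: ler_pM; rewrite ?mulr_ge0 ?exprn_ge0//.
    by apply: key; have := ltn_ord k; lia.
  rewrite -[in X in X -> _]addn2 exprD => h.
  have : `|ad| * U ^+ 2 <= (n.+2 * N)%N%:Z * L%:Z ^+ 2.
    by rewrite -(ler_pM2l (exprn_gt0 n U0)); lia.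
  have : L%:Z ^+ 2 * U ^+ 2 <= `|ad| * U ^+ 2 by rewrite ler_pM2r ?exprn_gt0.
  move=> h1 h2; have := le_trans h1 h2.
  by rewrite mulrC ler_pM2r ?exprn_gt0.
- by rewrite eqn// -mulrA abszM dvdn_mulr.
(* If the form vanishes, then u' = L, so f z = 1 lies on the orbit. The relation there reads L F(1,
   1) = a_0 (u(f 1) - L), and L divides a_d. *)
- rewrite eqn// => /eqP; rewrite mulf_eq0 mulf_eq0 (gt_eqF a00) expf_eq0 (gt_eqF lL).
  rewrite andbF/= subr_eq0 => /eqP fzL.
  have fz1 : f z = 1 by rewrite (uE _ (cl _ zs)) fzL divff.
  have s1 : 1 \in s by rewrite -fz1 cl.
  have u1 : u 1 = L.
    by rewrite -fzL -fz1.
  have := eqn _ s1; rewrite u1 hform_scale exprSr => h.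
  have {}h : L%:Z * hform t ad 1 1 = a0 * (u (f 1) - L%:Z).
    apply: (@mulfI _ (L%:Z ^+ n.+1)); first by rewrite expf_neq0// gt_eqF.
    by rewrite mulrA h; ring.
  have : (L %| `|ad|)%N by apply: dvdn_trans L2; rewrite dvdn_mulr.
  move=> /(dvdn_mul (dvdnn `|hform t ad 1 1|)) h1.
  rewrite abszM mulnC (dvdn_trans _ h1)// mulnC -[L]/(`|L%:Z|%N) -abszM h.
  by rewrite abszM dvdn_mulr.
Qed.

(** * A covering list of pairs in degree at least 3 *)

Definition sym_interval (N : nat) : seq int := [seq i%:Z - N%:Z | i <- iota 0 (N + N).+1].

Lemma mem_sym_interval (N : nat) (x : int) : (x \in sym_interval N) = (`|x| <= N%:Z).
Proof.
apply/mapP/idP => [[i + ->]|xN]; first by rewrite mem_iota; lia.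
by exists (absz (x + N%:Z)); rewrite ?mem_iota; lia.
Qed.

Lemma size_sym_interval (N : nat) : size (sym_interval N) = (N + N).+1.
Proof. by rewrite size_map size_iota. Qed.

Definition sym_box (n N : nat) : seq (n.-tuple int) :=
  [seq map_tuple (fun i : 'I_(N + N).+1 => i%:Z - N%:Z) t
    | t <- enum [set: n.-tuple 'I_(N + N).+1]%SET].

Lemma size_sym_box (n N : nat) : size (sym_box n N) = ((N + N).+1 ^ n)%N.
Proof. by rewrite size_map -cardE cardsT card_tuple card_ord. Qed.

Lemma mem_sym_box (n N : nat) (t : n.-tuple int) :
  (t \in sym_box n N) = all (fun x : int => `|x| <= N%:Z) t.
Proof.
apply/mapP/allP => [[v _ ->] x|tN].
  by move=> /mapP[i _ ->]; have := ltn_ord i; lia.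
exists (map_tuple (fun x : int => inord (absz (x + N%:Z))) t).
  by rewrite mem_enum inE.
apply: val_inj => /=; rewrite -map_comp; apply/esym/map_id_in => x /tN xN /=.
by rewrite inordK; lia.
Qed.

Lemma size_allpairs_dep_le (S T V : eqType) (f : S -> T -> V) (s : seq S)
    (t : S -> seq T) (M : nat) : {in s, forall x, (size (t x) <= M)%N} ->
  (size [seq f x y | x <- s, y <- t x] <= size s * M)%N.
Proof.
move=> tM; rewrite size_allpairs_dep; elim: s tM => [//|x s IH] tM /=.
rewrite mulSn leq_add ?tM ?mem_head// IH// => y ys.
by rewrite tM// inE ys orbT.
Qed.

(* The pairs (psi_a, u/L) where (a_1, ..., a_d) runs over P, L over the divisors of
   a_d, u over [-K, K], and a_0 over the candidates D left by these choices. *)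
Definition pts (n : nat) (P : seq (n.-tuple int * int)) (K : nat)
    (D : n.-tuple int -> int -> int -> nat -> seq nat) : seq ({poly rat} * rat) :=
  [seq (psi (mkvec a0%:Z p.1.1.1 p.1.1.2), p.2%:~R / p.1.2%:R)
    | p <- [seq (q, u) | q <- [seq (r, L) | r <- P, L <- divisors `|r.2|],
                         u <- sym_interval K],
      a0 <- D p.1.1.1 p.1.1.2 p.2 p.1.2].

Lemma size_pts (n : nat) (P : seq (n.-tuple int * int)) (K T T' : nat)
    (D : n.-tuple int -> int -> int -> nat -> seq nat) :
    {in P, forall r, (size (divisors `|r.2|) <= T)%N} ->
    {in P, forall r L u, L \in divisors `|r.2| -> u \in sym_interval K ->
      (size (D r.1 r.2 u L) <= T')%N} ->
  (size (pts P K D) <= size P * T * (K + K).+1 * T')%N.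
Proof.
move=> PT PT'; apply: leq_trans (size_allpairs_dep_le _ _) _.
  move=> _ /allpairsP[[_ u] /= [/allpairsPdep[r [L [rP rL ->]]] uK ->]] /=.
  exact: PT'.
rewrite leq_mul2r size_allpairs size_sym_interval leq_mul2r/=; apply/orP; right.
exact: size_allpairs_dep_le.
Qed.

Lemma mem_pts (n : nat) (P : seq (n.-tuple int * int)) (K : nat)
    (D : n.-tuple int -> int -> int -> nat -> seq nat) t ad u L (a0 : nat) :
    (t, ad) \in P -> L \in divisors `|ad| -> u \in sym_interval K ->
    a0 \in D t ad u L ->
  (psi (mkvec a0%:Z t ad), u%:~R / L%:R) \in pts P K D.
Proof.
move=> tP LD uK aD; apply/allpairsPdep; exists ((t, ad, L), u), a0; split=> //.
by apply: allpairs_f => //; apply/allpairsPdep; exists (t, ad), L.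
Qed.

(** There are n+1 monomials of degree n+2. The bound keeps the form within the range where T bounds
    the number of divisors. *)
Lemma hform_bound (n N B : nat) (t : n.-tuple int) (ad u v : int) :
    `|ad| <= N%:Z -> (forall k : 'I_n, `|t`_k| <= N%:Z) ->
    `|u| <= B%:Z -> `|v| <= B%:Z ->
  (`|hform t ad u v| <= n.+1 * N * B ^ n.+2)%N.
Proof.
move=> adN tN uB vB.
suff : `|hform t ad u v| <= n.+1%:Z * N%:Z * B%:Z ^+ n.+2.
  by rewrite -!natz -natrX -!natrM !natz; lia.
apply: (le_trans (ler_normD _ _)).
have -> : n.+1%:Z * N%:Z * B%:Z ^+ n.+2 =
    N%:Z * B%:Z ^+ n.+2 + \sum_(k < n) N%:Z * B%:Z ^+ n.+2.
  by rewrite sumr_const card_ord -mulr_natr natz; lia.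
apply: lerD.
  by rewrite normrM normrX ler_pM// ?exprn_ge0// lerXn2r ?nnegrE.
apply: (le_trans (ler_norm_sum _ _ _)); apply: ler_sum => k _.
have -> : n.+2 = (k.+1 + (n.+1 - k))%N by have := ltn_ord k; lia.
rewrite !normrM !normrX exprD mulrA; apply: ler_pM; rewrite ?mulr_ge0 ?exprn_ge0//.
  by apply: ler_pM; rewrite ?exprn_ge0// lerXn2r ?nnegrE.
by rewrite lerXn2r ?nnegrE.
Qed.

(** The two terms match the cases F(1, 1) != 0 and F(1, 1) = 0. In the second, a_d is determined by
    t, which makes up for letting a_0 run over all of [1, N]. *)
Lemma prep_cover (n N K T : nat) : (0 < n)%N -> (0 < N)%N ->
    (n.+2 * N < K.+1 ^ 2)%N -> (K <= n.+2 * N)%N ->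
    (forall m, (0 < m <= n.+2 * (n.+2 * N) ^ n.+3)%N -> (size (divisors m) <= T)%N) ->
  exists W : seq ({poly rat} * rat),
    (size W <= (N + N).+1 ^ n.+1 * T * (K + K).+1 * T +
               (N + N).+1 ^ n * T * (K + K).+1 * N)%N /\
    forall (a : n.+2.-tuple int) (z : rat), admissible a -> (height a <= N)%N ->
      Prep (fun z : rat => (psi a).[z]) z -> (psi a, z) \in W.
Proof.
move=> n0 N0 NK KN divT.
pose B := (n.+2 * N)%N.
have B0 : (0 < B)%N by rewrite muln_gt0.
(* The value 0 must be allowed, since the lists also contain vectors with a_d = 0 or a vanishing
   form; [divisors 0] is [[:: 1]]. *)
have {}divT m : (m <= n.+2 * B ^ n.+3)%N -> (size (divisors m) <= T)%N.
  case: m => [_|m mB]; last by rewrite divT.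
  by rewrite (divT 1%N)//= muln_gt0 expn_gt0 B0.
have BX : (B * B <= B ^ n.+3)%N.
  by rewrite mulnn leq_pexp2l.
have B1 : (B <= B * B)%N by rewrite leq_pmulr.
pose P1 := [seq (t, ad) | t <- sym_box n N, ad <- sym_interval N].
pose P2 := [seq (t, - \sum_(k < n) t`_k) | t : n.-tuple int <- sym_box n N].
pose D1 (t : n.-tuple int) (ad u : int) (L : nat) :=
  divisors `|if hform t ad u L != 0 then hform t ad u L else (ad * hform t ad 1 1)%R|.
exists (pts P1 K D1 ++ pts P2 K (fun _ _ _ _ => iota 1 N)); split.
  rewrite size_cat leq_add//.
    apply: (leq_trans (size_pts (T := T) (T' := T) _ _)).
    - move=> _ /allpairsP[[t ad] /= [_ + ->]] /=; rewrite mem_sym_interval => adN.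
      by apply: divT; nia.
    - move=> _ /allpairsP[[t ad] /= [tN adN ->]] L u /= Ld uK.
      move: adN uK; rewrite !mem_sym_interval => adN uK.
      have {}tN (k : 'I_n) : `|t`_k| <= N%:Z.
        by move: tN; rewrite mem_sym_box => /allP; apply; rewrite mem_nth ?size_tuple.
      apply: divT; case: ifP => _.
        have LB : `|L%:Z| <= B%:Z.
          have [ad0|ad0] := eqVneq ad 0.
            by move: Ld; rewrite ad0 /= inE => /eqP->; lia.
          move: Ld; rewrite -dvdn_divisors ?absz_gt0// => /dvdn_leq.
          by rewrite absz_gt0 => /(_ ad0); rewrite /B; nia.
        have uB : `|u| <= B%:Z by rewrite (le_trans uK).
        apply: (leq_trans (hform_bound adN tN uB LB)).
        by rewrite [(_ ^ n.+3)%N]expnS mulnA leq_mul2r; apply/orP; right; rewrite /B; nia.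
      have B11 : `|1 : int| <= 1%N%:Z by [].
      have := hform_bound adN tN B11 B11; rewrite exp1n muln1 abszM => h.
      by rewrite /B in BX *; nia.
    - by rewrite /P1 size_allpairs size_sym_box size_sym_interval -expnSr.
  apply: (leq_trans (size_pts (T := T) (T' := N) _ _)).
  - move=> _ /mapP[t + ->] /=; rewrite mem_sym_box => tN.
    have : `|\sum_(k < n) t`_k| <= \sum_(k < n) N%:Z.
      apply: (le_trans (ler_norm_sum _ _ _)); apply: ler_sum => k _.
      by apply: (allP tN); rewrite mem_nth ?size_tuple.
    rewrite sumr_const card_ord -mulr_natr natz; move: (\sum_(_ < _) _) => y h.
    apply: divT; rewrite abszN; apply: (@leq_trans B); first by rewrite /B; nia.
    by rewrite (leq_trans B1)// (leq_trans BX)// leq_pmull.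
  - by move=> *; rewrite size_iota.
  - by rewrite size_map size_sym_box.
move=> a z; have [t ->] := mkvecE a; move: (a`_0) (a`_n.+1) => a0 ad.
case=> _; rewrite mkvec_last => ad0 a00.
have {}a00 : 0 < a0 := a00.
rewrite height_le /= all_rcons => /and3P[a0N adN tN].
have tb : t \in sym_box n N.
  by rewrite mem_sym_box; apply: sub_all tN => x; lia.
have {}a0N : `|a0| <= N%:Z by lia.
have {}adN : `|ad| <= N%:Z by lia.
have {}tN (k : 'I_n) : `|t`_k| <= N%:Z.
  by have /allP/(_ t`_k) := tN; rewrite mem_nth ?size_tuple// => /(_ isT); lia.
move=> /(preperiodic_constraints n0 ad0 a00 a0N adN tN)[L [u [-> L2 uN a0F a0s]]].
have uK : u \in sym_interval K.
  have : (`|u| ^ 2 < K.+1 ^ 2)%N by apply: leq_ltn_trans NK.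
  by rewrite ltn_exp2r// mem_sym_interval; lia.
have Ld : L \in divisors `|ad|.
  by rewrite -dvdn_divisors ?absz_gt0// (dvdn_trans _ L2)// dvdn_mulr.
have a0E : a0 = `|a0|%N by rewrite gez0_abs// ltW.
rewrite mem_cat; apply/orP.
have [s0|s0] := eqVneq (hform t ad 1 1) 0; last first.
  left; rewrite a0E; apply: mem_pts => //.
    by apply: allpairs_f; rewrite ?mem_sym_interval.
  have [F0|F0] := eqVneq (hform t ad u L) 0; rewrite /D1.
    by rewrite F0 eqxx /= -dvdn_divisors ?absz_gt0 ?mulf_neq0// a0s.
  by rewrite F0 -dvdn_divisors ?absz_gt0.
right; rewrite a0E; apply: mem_pts => //.
  apply/mapP; exists t => //; congr (_, _); apply/eqP.
  rewrite -addr_eq0; move/eqP: s0; rewrite /hform expr1n mulr1.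
  by under eq_bigr do rewrite !expr1n !mulr1.
by rewrite mem_iota; move: a00 a0N; clear; lia.
Qed.

(** * Degree 2 *)

(** Scaling by c = a_2/a_0 turns the map into Z^2 + c, and over the common denominator M of the
    scaled orbit the relation becomes a_0 (U' M - U^2) = a_2 M^2. *)
Lemma quadratic_preperiodic_constraints (a0 ad : int) (N K : nat) (z : rat) :
    coprime `|a0| `|ad| -> 0 < a0 -> ad != 0 -> `|a0| <= N%:Z -> `|ad| <= N%:Z ->
    (N < K.+1 ^ 2)%N ->
    Prep (fun z : rat => (psi (mkvec a0 [tuple] ad)).[z]) z ->
  exists (M : nat) (U U' : int),
    [/\ (0 < M <= K)%N, a0 = M%:Z ^+ 2, ad = U' * M%:Z - U ^+ 2,
        (`|U| <= (3 * K)%N%:Z) && (`|U'| <= (3 * K)%N%:Z) & z = M%:R * U%:~R / ad%:~R].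
Proof.
move=> co a00 ad0 a0N adN NK /prep_orbit[s [zs cl]].
pose c : rat := ad%:~R / a0%:~R.
have a0r : a0%:~R != 0 :> rat by rewrite intr_eq0 gt_eqF.
have adr : ad%:~R != 0 :> rat by rewrite intr_eq0.
pose S := [seq c * w | w <- s].
have czS : c * z \in S by apply: map_f.
have clS : {in S, forall w, w ^+ 2 + c \in S}.
  move=> _ /mapP[w /cl ws ->]; have := map_f ( *%R c) ws.
  rewrite /psi !hornerD hornerZ hornerXn hornerC mkvec_last big_geq// horner0 addr0.
  by rewrite -/c mulrDr mulr1 exprMn mulrA -expr2.
have [M [u [M0 uE Mmin]]] := common_den S.
have Mr : M%:R != 0 :> rat by rewrite pnatr_eq0 -lt0n.
pose v w := u (w ^+ 2 + c).
have eqn w : w \in S -> a0 * (v w * M%:Z - u w ^+ 2) = ad * M%:Z ^+ 2.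
  move=> wS; have := uE _ (clS _ wS); rewrite -/(v w) {1}(uE _ wS) /c => h.
  apply/eqP; rewrite -(eqr_int rat); apply/eqP.
  rewrite !(rmorphM, rmorphB, rmorphXn)/= -[M%:~R]/(M%:R).
  have -> : (v w)%:~R = M%:R * ((v w)%:~R / M%:R) :> rat by field.
  by rewrite -h; field; apply/andP.
have : (`|a0| %| M ^ 2)%N.
  have := congr1 absz (eqn _ czS); rewrite abszM [in RHS]abszM abszX => e.
  by rewrite -(Gauss_dvdr _ co) -e dvdn_mulr.
case/dvdnP => q Mq.
have a0E : a0 = `|a0|%N by rewrite gez0_abs// ltW.
have Mq' : M%:Z ^+ 2 = a0 * q%:Z by rewrite [in RHS]a0E -PoszM mulnC -Mq.
have eqn2 w : w \in S -> v w * M%:Z - u w ^+ 2 = ad * q%:Z.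
  move=> wS; apply: (@mulfI _ a0); first by rewrite gt_eqF.
  by rewrite eqn// Mq'; ring.
(* Here M^2 = a_0 q. Since u^2 = U' M - a_2 q, its square is divisible by q, so q divides every u^4
   as well as M^2, and [common_den] gives q = 1. *)
have q1 : q = 1%N.
  apply/eqP; rewrite -dvdn1; apply: (Mmin q 1%N 4%N 2%N).
    by rewrite Mq dvdn_mulr.
  move=> w wS; rewrite mul1n -abszX.
  have -> : u w ^+ 4 = q%:Z * (v w ^+ 2 * a0 - 2 * v w * M%:Z * ad + ad ^+ 2 * q%:Z).
    have -> : u w ^+ 4 = (v w * M%:Z - (v w * M%:Z - u w ^+ 2)) ^+ 2 by ring.
    rewrite eqn2//; have -> : (v w * M%:Z - ad * q%:Z) ^+ 2 =
      v w ^+ 2 * M%:Z ^+ 2 - 2 * v w * M%:Z * ad * q%:Z + (ad * q%:Z) ^+ 2 by ring.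
    by rewrite Mq'; ring.
  by rewrite abszM dvdn_mulr.
rewrite {}q1 in Mq' eqn2.
have {}Mq' : M%:Z ^+ 2 = a0 by rewrite Mq' mulr1.
have {}eqn2 w : w \in S -> v w * M%:Z - u w ^+ 2 = ad by move=> /eqn2->; rewrite mulr1.
have MK : (M <= K)%N.
  have : (M ^ 2 < K.+1 ^ 2)%N by lia.
  by rewrite ltn_exp2r.
(* At the largest numerator U, the relation gives U^2 <= U K + N with N < (K+1)^2, which excludes U
   > 3K. *)
have uK w : w \in S -> `|u w| <= (3 * K)%N%:Z.
  have [y yS ymax] := seq_max (fun w => `|u w|%N) czS.
  move=> /ymax wy; suff : (`|u y| <= 3 * K)%N by lia.
  have := ymax _ (clS _ yS); rewrite -/(v y) => vy.
  have h : (`|u y| * `|u y| <= `|u y| * K + N)%N.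
    rewrite -abszM -expr2.
    have -> : u y ^+ 2 = v y * M%:Z - ad by rewrite -(eqn2 _ yS); ring.
    have : (`|(v y * M%:Z)%R| <= `|u y| * K)%N by rewrite abszM leq_mul.
    by lia.
  by rewrite leqNgt; apply/negP => hK; nia.
exists M, (u (c * z)), (v (c * z)); split=> //.
- by rewrite M0.
- by rewrite eqn2.
- by rewrite !uK// clS.
- have := uE _ czS => h.
  have -> : (u (c * z))%:~R = M%:R * (c * z) by rewrite {2}h; field.
  have -> : c = ad%:~R / M%:R ^+ 2 by rewrite /c -Mq' rmorphXn.
  by field; apply/andP.
Qed.

(** The triple (M, U, U') determines a_0, a_2 and z, so it suffices to list triples. *)
Lemma prep_cover2 (N K : nat) : (N < K.+1 ^ 2)%N ->
  exists W : seq ({poly rat} * rat),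
    size W = (K * (3 * K + 3 * K).+1 * (3 * K + 3 * K).+1)%N /\
    forall (a : 2.-tuple int) (z : rat), admissible a -> (height a <= N)%N ->
      Prep (fun z : rat => (psi a).[z]) z -> (psi a, z) \in W.
Proof.
move=> NK; pose ad (p : nat * int) (U' : int) := U' * p.1%:Z - p.2 ^+ 2.
pose g (p : nat * int) (U' : int) :=
  (psi (mkvec (p.1%:Z ^+ 2) [tuple] (ad p U')), p.1%:R * p.2%:~R / (ad p U')%:~R : rat).
exists [seq g p U' | p <- [seq (M, U) | M <- iota 1 K, U <- sym_interval (3 * K)],
                     U' <- sym_interval (3 * K)].
split; first by rewrite !size_allpairs !size_sym_interval size_iota.
move=> a z; have [t ->] := mkvecE a; rewrite [t]tuple0; move: (a`_0) (a`_1) => a0 a2.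
case=> pr; rewrite mkvec_last => ad0 a00.
have {}a00 : 0 < a0 := a00.
rewrite height_le /= => /and3P[a0N adN _].
have co : coprime `|a0| `|a2|.
  by move: pr; rewrite /primitive /= !big_cons big_nil gcdn0 => /eqP.
move=> /(@quadratic_preperiodic_constraints a0 a2 N K z co a00 ad0)
  [||//|M [U [U' [MK -> a2E /andP[UK U'K] ->]]]]; try lia.
have MU : (M, U) \in [seq (M, U) | M <- iota 1 K, U <- sym_interval (3 * K)].
  by apply: allpairs_f; rewrite ?mem_sym_interval ?mem_iota//; lia.
have U'r : U' \in sym_interval (3 * K) by rewrite mem_sym_interval.
by rewrite a2E; exact: (allpairs_f g MU U'r).
Qed.

(** * Final estimates in X *)

Lemma nat_sqrt (m : nat) : exists K : nat, (K ^ 2 <= m < K.+1 ^ 2)%N.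
Proof.
elim: m => [|m [K /andP[Km mK]]]; first by exists 0%N.
by have [h|h] := leqP (K.+1 ^ 2) m.+1; [exists K.+1|exists K]; nia.
Qed.

(** For d >= 3 this amounts to 4(d+1) <= 5d+1, with equality at d = 3. *)
Lemma theta_le (R : realType) (d : nat) : (2 <= d)%N -> theta R d <= 1 / 2.
Proof.
rewrite /theta; case: eqP => // d2 d2'.
have d3 : 3 <= d%:R :> R by rewrite ler_nat; lia.
have d1 : 0 < 5 * d%:R + 1 :> R by lra.
by rewrite ler_pdivrMr//; lra.
Qed.

Lemma cover_bound (R : realType) (n : nat) (eps : R) : 0 < eps ->
  exists2 C : R, 0 < C & forall X : R, 1 <= X ->
  exists W : seq ({poly rat} * rat),
    (size W)%:R <= C * (Num.truncn X)%:R ^+ n.+2 * X `^ (eps - 1 / 2) /\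
    forall (a : n.+2.-tuple int) (z : rat), admissible a ->
      (height a <= Num.truncn X)%N ->
      Prep (fun z : rat => (psi a).[z]) z -> (psi a, z) \in W.
Proof.
move=> eps0.
(* K is the integer square root of (n+2)N. Then K <= (n+2) X^(1/2), and X < N+1 <= 2N trades X^(1/2)
   for 2 N X^(-1/2); hence the extra factor 2(n+2). *)
suff [C C0 HC] : exists2 C : R, 0 < C & forall (X : R) (N K : nat), 1 <= X ->
    (0 < N)%N -> N%:R <= X -> (0 < K)%N -> (K ^ 2 <= n.+2 * N < K.+1 ^ 2)%N ->
    exists W : seq ({poly rat} * rat),
    (size W)%:R <= C * N%:R ^+ n.+1 * K%:R * X `^ eps /\
    forall (a : n.+2.-tuple int) (z : rat), admissible a -> (height a <= N)%N ->
      Prep (fun z : rat => (psi a).[z]) z -> (psi a, z) \in W.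
  exists (C * (n.+2%:R * 2)); first by rewrite mulr_gt0// mulr_gt0// ltr0n.
  move=> X X1; have X0 : 0 < X by lra.
  have := truncn_itv (ltW X0); set N := Num.truncn X => /andP[NX XN].
  have N0 : (0 < N)%N by rewrite truncn_gt0.
  have N1 : 1 <= N%:R :> R by rewrite ler1n.
  have [K KN] := nat_sqrt (n.+2 * N).
  have K0 : (0 < K)%N by case: K KN => //; lia.
  have [W [Wsz WP]] := HC X N K X1 N0 NX K0 KN.
  exists W; split=> //; apply: (le_trans Wsz).
  rewrite powRD; last by apply/implyP => _; rewrite gt_eqF.
  have XXh : X = X `^ (1 / 2) * X `^ (1 / 2).
    by rewrite -powRD ?(gt_eqF X0) ?implybT// -splitr powRr1// ltW.
  have h0 : 0 < X `^ (1 / 2) by rewrite powR_gt0.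
  have Kh : K%:R <= n.+2%:R * X `^ (1 / 2).
    rewrite -(@ler_pXn2r _ 2)// ?nnegrE ?mulr_ge0 ?powR_ge0//.
    rewrite exprMn [(X `^ _) ^+ 2]expr2 -XXh -natrX.
    apply: (@le_trans _ _ (n.+2%:R * N%:R)); first by rewrite -natrM ler_nat; lia.
    rewrite expr2 -mulrA ler_pM2l ?ltr0n//.
    by rewrite (le_trans NX)// ler_peMl// ?ler1n// ltW.
  have hN : X `^ (1 / 2) <= 2 * N%:R * X `^ (- (1 / 2)).
    rewrite powRN ler_pdivlMr// -XXh; apply: (le_trans (ltW XN)).
    by rewrite -natr1; lra.
  have e0 : 0 < X `^ eps by rewrite powR_gt0.
  have -> : C * (n.+2%:R * 2) * N%:R ^+ n.+2 * (X `^ eps * X `^ (- (1 / 2))) =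
      C * N%:R ^+ n.+1 * (n.+2%:R * (2 * N%:R * X `^ (- (1 / 2)))) * X `^ eps.
    by rewrite [_ ^+ n.+2]exprSr; ring.
  rewrite ler_pM2r// ler_pM2l ?mulr_gt0 ?exprn_gt0//; last lra.
  by rewrite (le_trans Kh)// ler_pM2l// ltr0n.
have Xe (X : R) : 1 <= X -> 1 <= X `^ eps.
  by move=> X1; rewrite -[leLHS](powRr0 X) ler_powR// ltW.
case: n => [|n].
  (* K (6K+1)^2 <= 49 K^3 and K^2 <= 2N. *)
  exists 98 => // X N K X1 N0 NX K0 /andP[KN NK].
  have [|W [Wsz WP]] := @prep_cover2 N K; first by lia.
  exists W; split=> //.
  have : (size W <= 98 * N * K)%N by rewrite Wsz; nia.
  rewrite -(ler_nat R) !natrM expr1 => h; apply: (le_trans h).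
  by rewrite -[leLHS]mulr1 ler_wpM2l ?Xe ?mulr_ge0.
(* The degree is now n+3, and the divisor counts concern integers up to a constant times N^(n+4).
   This k gives (n+4)/(k+1) < eps/2, so T is O(X^(eps/2)), and T^2 is O(X^eps). *)
pose k := Num.truncn ((n + 4)%:R * 2 / eps).
have [c hc] := divisors_bound k.
pose c1 : R := (c * n.+3 ^ (n + 5))%:R `^ (1 / k.+1%:R).
have T0 : 0 < 1 + c1 by rewrite ltr_wpDr// powR_ge0.
exists (6 * 3 ^+ n.+2 * (1 + c1) ^+ 2).
  by rewrite mulr_gt0 ?exprn_gt0// mulr_gt0 ?exprn_gt0.
move=> X N K X1 N0 NX K0 /andP[KN NK].
have X0 : 0 < X by lra.
pose M := (n.+3 * (n.+3 * N) ^ (n + 4))%N.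
pose T := (\max_(1 <= m < M.+1) size (divisors m))%N.
have TM : (T ^ k.+1 <= c * M)%N.
  rewrite /T big_nat; elim/big_ind: _ => [|x y hx hy|m /andP[m0 mM]].
  - by rewrite exp0n.
  - by rewrite /maxn; case: ifP.
  - by rewrite (leq_trans (hc _ m0))// leq_mul2l -ltnS mM orbT.
have TX : T%:R <= (1 + c1) * X `^ (eps / 2).
  apply: (@le_trans _ _ (c1 * X `^ (eps / 2))); last first.
    by rewrite ler_wpM2r ?powR_ge0// lerDr.
  have k0 : 0 < k.+1%:R :> R by rewrite ltr0n.
  have -> : T%:R = ((T%:R : R) ^+ k.+1) `^ (1 / k.+1%:R).
    by rewrite -powR_mulrn// -powRrM mul1r divff ?gt_eqF// powRr1.
  apply: (@le_trans _ _ (((c * n.+3 ^ (n + 5))%:R * X ^+ (n + 4)) `^ (1 / k.+1%:R))).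
    apply: ge0_ler_powR; rewrite ?nnegrE ?divr_ge0 ?mulr_ge0 ?exprn_ge0 ?(ltW X0)//.
    apply: (@le_trans _ _ (c * n.+3 ^ (n + 5) * N ^ (n + 4))%:R).
      by rewrite -natrX ler_nat (leq_trans TM)// /M expnMn [(n + 5)%N]addnS expnS !mulnA.
    by rewrite natrM ler_wpM2l// natrX lerXn2r ?nnegrE// ltW.
  rewrite powRM ?exprn_ge0 ?(ltW X0)// ler_wpM2l ?powR_ge0//.
  rewrite -powR_mulrn ?(ltW X0)// -powRrM ler_powR//.
  rewrite mulrA mulr1 ler_pdivrMr//.
  have : (n + 4)%:R * 2 / eps < k.+1%:R.
    by rewrite truncnS_gt.
  by rewrite ltr_pdivrMr// => h; lra.
have [|||||W [Wsz WP]] := @prep_cover n.+1 N K T => //.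
- have K1 : (K <= K ^ 2)%N by rewrite leq_pmulr.
  exact: leq_trans K1 KN.
- move=> m /andP[m0 mM]; rewrite /T (big_rem m) ?leq_maxl//=.
  by rewrite mem_index_iota m0 ltnS /M addnC.
exists W; split=> //.
have T1 : (0 < T)%N.
  have M0 : (0 < M)%N by rewrite muln_gt0 expn_gt0 muln_gt0 N0.
  by rewrite /T (big_rem 1%N) ?mem_index_iota//= leq_max.
(* Use 2N+1 <= 3N and 2K+1 <= 3K; each of the two terms contributes 3 to the 6. *)
have : (size W <= 6 * 3 ^ n.+2 * N ^ n.+2 * K * T ^ 2)%N.
  apply: (leq_trans Wsz).
  have N3 : ((N + N).+1 <= 3 * N)%N by lia.
  have e1 : ((N + N).+1 ^ n.+2 <= 3 ^ n.+2 * N ^ n.+2)%N by rewrite -expnMn leq_exp2r.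
  have e2 : ((N + N).+1 ^ n.+1 * N <= 3 ^ n.+2 * N ^ n.+2)%N.
    rewrite -expnMn [leqRHS]expnSr leq_mul//; last by lia.
    by rewrite leq_exp2r.
  move: e1 e2; move: ((N + N).+1 ^ n.+2)%N ((N + N).+1 ^ n.+1)%N => x y.
  have -> : (6 * 3 ^ n.+2 * N ^ n.+2 * K * T ^ 2)%N =
            (3 ^ n.+2 * N ^ n.+2 * (6 * K * T ^ 2))%N by ring.
  move: (3 ^ n.+2 * N ^ n.+2)%N => w xw yw.
  apply: (@leq_trans (w * (3 * K * T ^ 2) + w * (3 * K * T ^ 2))); last by lia.
  apply: leq_add.
    by rewrite -!mulnA leq_mul//; nia.
  have -> : (y * T * (K + K).+1 * N = y * N * (T * (K + K).+1))%N by ring.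
  by rewrite leq_mul//; nia.
rewrite -(ler_nat R) 4!natrM !natrX => h; apply: (le_trans h).
have -> : 6 * 3 ^+ n.+2 * (1 + c1) ^+ 2 * N%:R ^+ n.+2 * K%:R * X `^ eps =
  6 * 3 ^+ n.+2 * N%:R ^+ n.+2 * K%:R * ((1 + c1) * X `^ (eps / 2)) ^+ 2.
  rewrite exprMn [(X `^ _) ^+ 2]expr2 -powRD; last by apply/implyP => _; rewrite gt_eqF.
  by rewrite -splitr; ring.
apply: ler_wpM2l.
  by rewrite mulr_ge0// mulr_ge0 ?exprn_ge0// mulr_ge0 ?exprn_ge0.
by rewrite lerXn2r ?nnegrE ?mulr_ge0 ?powR_ge0 ?(ltW T0).
Qed.

Theorem theorem1p1 (R : realType) (d : nat) (eps : R)
    (hd : (2 <= d)%N) (heps : 0 < eps) :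
  exists2 C : R, 0 < C & forall X : R, 1 <= X ->
    ((1 / (#|` fset_set (polys d X)|%fset)%:R)%:E
      * \sum_(f \in polys d X) @counting _ R (Prep (fun z : rat => f.[z]))
     <= (C * (1 / X `^ (theta R d - eps)))%:E)%E.
Proof.
case: d hd => [//|[//|n]] _.
have [C C0 HC] := cover_bound n heps.
(* The 4 comes from N^d <= 4 #P_d(X) in [card_polys]. *)
exists (4 * C); first by rewrite mulr_gt0.
move=> X X1; have X0 : 0 < X by lra.
have [W [Wsz WP]] := HC X X1; set N := Num.truncn X in Wsz WP.
have N0 : (0 < N)%N by rewrite truncn_gt0.
have sumW : (\sum_(f \in polys n.+2 X) @counting _ R (Prep (fun z : rat => f.[z]))
    <= (size W)%:R%:E)%E.
  apply: sum_counting_le; first exact: finite_polys.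
  move=> _ z [a [adm hX] <-]; apply: WP => //.
  by rewrite truncn_ge_nat// ltW.
have := card_polys n X1; rewrite -/N; set c := #|`_| => Nc.
have c0 : 0 < c%:R :> R.
  by rewrite ltr0n; have : (0 < N ^ n.+2)%N; rewrite ?expn_gt0 ?N0//; lia.
apply: (@le_trans _ _ ((1 / c%:R)%:E * (size W)%:R%:E)%E).
  by apply: lee_wpmul2l => //; rewrite lee_fin divr_ge0// ltW.
rewrite -EFinM lee_fin mul1r mulrC ler_pdivrMr// (le_trans Wsz)//.
have NR : N%:R ^+ n.+2 <= 4 * c%:R :> R by rewrite -natrX -natrM ler_nat.
rewrite [1 / X `^ _]div1r -powRN.
(* The saving 1/2 is weakened to theta_d here, using X >= 1. *)
have Xle : X `^ (eps - 1 / 2) <= X `^ (- (theta R n.+2 - eps)).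
  by apply: ler_powR => //; have := @theta_le R n.+2 isT; lra.
have -> : 4 * C * X `^ (- (theta R n.+2 - eps)) * c%:R =
  C * (4 * c%:R) * X `^ (- (theta R n.+2 - eps)) by ring.
apply: ler_pM; rewrite ?powR_ge0//; last by rewrite ler_pM2l.
by rewrite mulr_ge0 ?exprn_ge0// ltW.
Qed.
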